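(* Let $r\in\mathbb R_{\ge 2}$ be irrational, and let $(p_n)_n,(q_n)_n$ be sequences of positive integers with $p_n/q_n\ge 2$ for all $n$ and $p_n/q_n\to r$. Then the sequence of fraction graphs $E_{p_n/q_n}$ is a Cauchy sequence in the asymptotic spectrum distance.
   Context: Graphs here are finite and simple. $E_n$ denotes the graph with $n$ vertices and no edges, $G\sqcup H$ the disjoint union, and $G\boxtimes H$ the strong product: its vertex set is $V(G)\times V(H)$, and distinct $(a,x),(b,y)$ are adjacent iff ($a=b$ or $\{a,b\}\in E(G)$) and ($x=y$ or $\{x,y\}\in E(H)$). A cohomomorphism $G\to H$ is a map $f:V(G)\to V(H)$ such that for all distinct non-adjacent $u,v\in V(G)$ the vertices $f(u),f(v)$ are distinct and non-adjacent in $H$. Write $G\le H$ if there is a cohomomorphism $G\to H$. The asymptotic spectrum of graphs $\mathcal X$ is the set of all maps $F$ from finite graphs to $\mathbb R_{\ge 0}$ with $F(G\sqcup H)=F(G)+F(H)$, $F(G\boxtimes H)=F(G)F(H)$, $F(E_n)=n$ for all $n\in\mathbb N$, and $G\le H\Rightarrow F(G)\le F(H)$. The asymptotic spectrum distance is $d(G,H)=\sup_{F\in\mathcal X}|F(G)-F(H)|$. A sequence $G_i$ is Cauchy if for every $\varepsilon>0$ there is $N$ with $d(G_i,G_j)\le\varepsilon$ for all $i,j>N$. For positive integers $p,q$ with $p/q\ge 2$, the fraction graph $E_{p/q}$ has vertex set $\{0,\dots,p-1\}$, and distinct $u,v$ are adjacent iff $u-v \bmod p<q$ or $v-u\bmod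 p<q$. *)

(* Defs.v *)
From HB Require Import structures.
From mathcomp Require Import all_boot all_order all_algebra.
From mathcomp Require Import all_classical all_reals all_analysis.
Import Order.TTheory GRing.Theory Num.Theory.
Import numFieldNormedType.Exports.

Set Implicit Arguments.
Unset Strict Implicit.
Unset Printing Implicit Defensive.

Local Open Scope ring_scope.
Local Open Scope classical_set_scope.

Record sgraph : Type := SGraph {
  vertex : finType;
  edge : rel vertex;
  edge_sym : symmetric edge;
  edge_irrefl : irreflexive edge }.

Section EmptyGraph.
Variable n : nat.

Definition empty_edge : rel 'I_n := fun _ _ => false.

Lemma empty_edge_sym : symmetric empty_edge. Proof. by []. Qed.

Lemma empty_edge_irrefl : irreflexive empty_edge. Proof. by []. Qed.

Definition empty_graph : sgraph := SGraph empty_edge_sym empty_edge_irrefl.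
End EmptyGraph.

Section DisjointUnion.
Variables G H : sgraph.

Definition disjoint_union_edge : rel (vertex G + vertex H)%type :=
  fun u v => match u, v with
  | inl a, inl b => edge a b
  | inr x, inr y => edge x y
  | _, _ => false
  end.

Lemma disjoint_union_edge_sym : symmetric disjoint_union_edge.
Proof. by move=> [a|x] [b|y] //=; exact: edge_sym. Qed.

Lemma disjoint_union_edge_irrefl : irreflexive disjoint_union_edge.
Proof. by move=> [a|x] /=; exact: edge_irrefl. Qed.

Definition disjoint_union : sgraph :=
  SGraph disjoint_union_edge_sym disjoint_union_edge_irrefl.
End DisjointUnion.

Section StrongProduct.
Variables G H : sgraph.

Definition strong_product_edge : rel (vertex G * vertex H)%type :=
  fun u v => [&& u != v, (u.1 == v.1) || edge u.1 v.1
                       & (u.2 == v.2) || edge u.2 v.2].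

Lemma strong_product_edge_sym : symmetric strong_product_edge.
Proof.
move=> u v; rewrite /strong_product_edge eq_sym (eq_sym u.1) (eq_sym u.2).
by rewrite (edge_sym u.1) (edge_sym u.2).
Qed.

Lemma strong_product_edge_irrefl : irreflexive strong_product_edge.
Proof. by move=> u; rewrite /strong_product_edge eqxx. Qed.

Definition strong_product : sgraph :=
  SGraph strong_product_edge_sym strong_product_edge_irrefl.
End StrongProduct.

Section FractionGraph.
Variables p q : nat.

(* The differences are taken in [int]: subtraction on [nat] is truncated. *)
Definition fraction_edge : rel 'I_p :=
  fun u v => (u != v) &&
    ((((u%:Z - v%:Z) %% p%:Z)%Z < q%:Z) || (((v%:Z - u%:Z) %% p%:Z)%Z < q%:Z)).

Lemma fraction_edge_sym : symmetric fraction_edge.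
Proof. by move=> u v; rewrite /fraction_edge eq_sym orbC. Qed.

Lemma fraction_edge_irrefl : irreflexive fraction_edge.
Proof. by move=> u; rewrite /fraction_edge eqxx. Qed.

Definition fraction_graph : sgraph :=
  SGraph fraction_edge_sym fraction_edge_irrefl.
End FractionGraph.

Definition cohomomorphism (G H : sgraph) (f : vertex G -> vertex H) : Prop :=
  forall u v : vertex G, u != v -> ~~ edge u v ->
    (f u != f v) /\ ~~ edge (f u) (f v).

Definition cohom_le (G H : sgraph) : Prop :=
  exists f : vertex G -> vertex H, cohomomorphism f.

(* A [Prop]-valued predicate and not a [set]: [sgraph] contains [finType], so
   [set (sgraph -> R)] is a universe inconsistency. *)
Record asymptotic_spectrum (R : realType) (F : sgraph -> R) : Prop := {
  spectrum_ge0 : forall G, 0 <= F G;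
  spectrum_union : forall G H, F (disjoint_union G H) = F G + F H;
  spectrum_product : forall G H, F (strong_product G H) = F G * F H;
  spectrum_empty : forall n, F (empty_graph n) = n%:R;
  spectrum_le : forall G H, cohom_le G H -> F G <= F H }.

(* The supremum is taken in the extended reals, where it always exists, so
   that no default value can stand in for it (the real-valued [sup] of an
   empty or unbounded set is 0). *)
Definition spectrum_distance (R : realType) (G H : sgraph) : \bar R :=
  ereal_sup [set x : \bar R | exists2 F : sgraph -> R,
    asymptotic_spectrum F & x = (`|F G - F H|)%:E].

Definition spectrum_cauchy (R : realType) (G : nat -> sgraph) : Prop :=
  forall e : R, 0 < e ->
    exists N : nat, forall i j : nat, (N < i)%N -> (N < j)%N ->
      (spectrum_distance R (G i) (G j) <= e%:E)%E.

(* Main.v *)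
Require Import Defs.
From mathcomp Require Import all_boot all_order all_algebra.
From mathcomp Require Import all_classical all_reals all_analysis.
From mathcomp Require Import zify lra.
Import Order.TTheory GRing.Theory Num.Theory.
Import numFieldNormedType.Exports.

Local Open Scope ring_scope.
Local Open Scope classical_set_scope.

(** Every F in the asymptotic spectrum is monotone along fraction graphs:
    E_{p/q} <= E_{p'/q'} as soon as p/q <= p'/q', by rounding u to
    floor(u p'/p) ([fraction_graph_le]).  So it suffices to enclose r in an
    interval p'/q' < r < p/q whose two ends have uniformly close values of F:
    the values at all p_n/q_n inside the interval are then squeezed together.

    The ends are neighbours in the Stern-Brocot tree, p q' - p' q = 1.  For
    such a pair the rounding map also works in the wrong direction, from
    E_{p/q} to E_{p'/q'}, except at the vertex 0, and after a rotation the
    exceptional vertex can be any prescribed one.  When p is large, one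
    exceptional vertex among p is harmless.  To see this, let n < p, choose
    n + 1 such maps with distinct exceptional vertices, and pass to strong
    powers.  A vertex of the n-th power has only n coordinates, so one of the
    maps is good on all of them; recording which one gives a cohomomorphism
    from E_{p/q}^n to E_{n+1} x E_{p'/q'}^n ([power_cohom_le]), hence
      F(E_{p/q})^n <= (n + 1) F(E_{p'/q'})^n,
    that is, F(E_{p/q}) <= (n + 1)^(1/n) F(E_{p'/q'}).  The factor tends to 1
    independently of F, and F(E_{p'/q'}) is at most floor(r) + 1, so the two
    values differ by at most e once n is large ([power_ratio_bound]).

    Since r is irrational, it is never hit by the Stern-Brocot descent towards
    it; the descent therefore produces enclosing neighbours with p as large as
    desired ([exists_neighbours]). *)

(** * Partial cohomomorphisms and strong powers *)

(** Adjacency in the complement graph: a cohomomorphism is a homomorphism of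
    complements, and the complement of a strong product is a disjunction. *)
Definition separated (G : sgraph) (u v : vertex G) : bool :=
  (u != v) && ~~ edge u v.

Definition cohom_on (G H : sgraph) (A : pred (vertex G))
    (f : vertex G -> vertex H) : Prop :=
  forall u v, A u -> A v -> separated G u v -> separated H (f u) (f v).

Lemma cohom_le_separated (G H : sgraph) (f : vertex G -> vertex H) :
  cohom_on G H predT f -> cohom_le G H.
Proof.
move=> fP; exists f => u v uv euv.
by apply/andP/fP => //; rewrite /separated uv.
Qed.

Lemma separated_sym (G : sgraph) : symmetric (separated G).
Proof. by move=> u v; rewrite /separated eq_sym edge_sym. Qed.

Lemma separated_product (G H : sgraph) (u v : vertex (strong_product G H)) :
  separated (strong_product G H) u v =
  separated G u.1 v.1 || separated H u.2 v.2.
Proof.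
case: u v => [a x] [b y]; rewrite /separated /= /strong_product_edge /=.
rewrite xpair_eqE; case: (eqVneq a b) => [->|_]; case: (eqVneq x y) => [->|_];
  rewrite ?edge_irrefl //=; by case: (edge a b); case: (edge x y).
Qed.

Fixpoint strong_power (G : sgraph) (n : nat) : sgraph :=
  if n is m.+1 then strong_product G (strong_power G m) else empty_graph 1.

Lemma spectrum_power (R : realType) (F : sgraph -> R) (G : sgraph) (n : nat) :
  asymptotic_spectrum F -> F (strong_power G n) = F G ^+ n.
Proof.
move=> FX; elim: n => [|n IHn] /=; first by rewrite (spectrum_empty FX) expr0.
by rewrite (spectrum_product FX) IHn exprS.
Qed.

Fixpoint coords (G : sgraph) (n : nat) :
    vertex (strong_power G n) -> seq (vertex G) :=
  if n is m.+1 then fun u => u.1 :: coords G m u.2 else fun=> [::].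

Lemma size_coords (G : sgraph) (n : nat) (u : vertex (strong_power G n)) :
  size (coords G n u) = n.
Proof. by elim: n u => //= n IHn u; rewrite IHn. Qed.

Fixpoint power_map (G H : sgraph) (f : vertex G -> vertex H) (n : nat) :
    vertex (strong_power G n) -> vertex (strong_power H n) :=
  if n is m.+1 then fun u => (f u.1, power_map G H f m u.2) else id.

Lemma power_map_cohom (G H : sgraph) (A : pred (vertex G))
    (f : vertex G -> vertex H) (n : nat) :
  cohom_on G H A f ->
  cohom_on (strong_power G n) (strong_power H n)
    (fun u => all A (coords G n u)) (power_map G H f n).
Proof.
move=> fA; elim: n => [|n IHn] //= u v /andP[Au Aus] /andP[Av Avs].
by rewrite !separated_product => /orP[/fA->//|/IHn->//]; rewrite orbT.
Qed.

Lemma exists_missed_value (T : eqType) (n : nat) (x : 'I_n.+1 -> T) (s : seq T) :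
  injective x -> (size s <= n)%N -> exists j, x j \notin s.
Proof.
move=> x_inj s_n; apply/existsP; apply: contraLR s_n.
rewrite negb_exists => /forallP xs; rewrite -ltnNge.
have: (size (codom x) <= size s)%N.
  apply: uniq_leq_size; first by rewrite map_inj_uniq ?enum_uniq.
  by move=> _ /codomP[j ->]; apply: negbNE.
by rewrite size_codom card_ord.
Qed.

(** Covering the n-th power of G by n + 1 pieces, one for each deleted vertex
    x j: the j-th piece consists of the tuples that avoid x j, and a tuple of
    length n cannot meet all of the n + 1 vertices.  The empty graph records
    the chosen piece, so that tuples from different pieces are separated for
    free. *)
Lemma power_cohom_le (G H : sgraph) (n : nat) (x : 'I_n.+1 -> vertex G)
    (f : 'I_n.+1 -> vertex G -> vertex H) :
  injective x -> (forall j, cohom_on G H (predC1 (x j)) (f j)) ->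
  cohom_le (strong_power G n)
    (strong_product (empty_graph n.+1) (strong_power H n)).
Proof.
move=> x_inj fP.
have miss u : exists j, x j \notin coords G n u.
  by apply: exists_missed_value; rewrite // size_coords.
pose J u := xchoose (miss u).
have JP u : all (predC1 (x (J u))) (coords G n u).
  by rewrite all_predC has_pred1; apply: xchooseP (miss u).
pose h u : vertex (strong_product (empty_graph n.+1) (strong_power H n)) :=
  (J u, power_map G H (f (J u)) n u).
apply: (@cohom_le_separated _ _ h) => u v _ _ uv; rewrite separated_product /=.
rewrite {1}/separated /= /empty_edge andbT.
have [Juv|//] := eqVneq (J u) (J v); rewrite -Juv.
by apply: (power_map_cohom _ _ _ _ _ (fP (J u))) => //=; rewrite Juv; apply: JP.
Qed.

Lemma spectrum_power_le (R : realType) (F : sgraph -> R) (G H : sgraph) (n : nat)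
    (x : 'I_n.+1 -> vertex G) (f : 'I_n.+1 -> vertex G -> vertex H) :
  asymptotic_spectrum F ->
  injective x -> (forall j, cohom_on G H (predC1 (x j)) (f j)) ->
  F G ^+ n <= n.+1%:R * F H ^+ n.
Proof.
move=> FX x_inj fP; have := spectrum_le FX (power_cohom_le _ _ _ _ _ x_inj fP).
by rewrite (spectrum_product FX) (spectrum_empty FX) !spectrum_power.
Qed.

(** * Rounding maps between fraction graphs *)

(** Circular distance at least q, without modular arithmetic: the two
    disjuncts correspond to the order of u and v. *)
Lemma fraction_separatedE (p q : nat) (u v : 'I_p) : (0 < q)%N ->
  separated (fraction_graph p q) u v =
  ((v + q <= u) && (u + q <= v + p))%N || ((u + q <= v) && (v + q <= u + p))%N.
Proof.
move=> q0; rewrite /separated /= /fraction_edge.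
have modE (a b : 'I_p) : ((a%:Z - b%:Z) %% p%:Z)%Z =
    if (b <= a)%N then (a - b)%N%:Z else (a + p - b)%N%:Z.
  have lta := ltn_ord a; have ltb := ltn_ord b.
  case: leqP => ab.
    by rewrite subzn // modz_nat modn_small // (leq_ltn_trans (leq_subr _ _)).
  have -> : (a%:Z - b%:Z)%R = (a + p - b)%N%:Z - p%:Z :> int by lia.
  by rewrite -[X in _ - X]mul1r -mulNr addrC modzMDl modz_nat modn_small //; lia.
rewrite !modE -(inj_eq val_inj) /=.
have := ltn_ord u; have := ltn_ord v.
move: (nat_of_ord u) (nat_of_ord v) => a b.
by case: (ltngtP a b) => ab; lia.
Qed.

(** Two points of the line at distance between q and p - q wrap to separated
    points of the circle of length p. *)
Lemma separated_mod (p q a b : nat) (lta : (a %% p < p)%N) (ltb : (b %% p < p)%N) :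
  (0 < q)%N -> (b + q <= a)%N -> (a + q <= b + p)%N ->
  separated (fraction_graph p q) (Ordinal lta) (Ordinal ltb).
Proof.
move=> q0 ba ab; rewrite fraction_separatedE //=.
have ea := divn_eq a p; have eb := divn_eq b p.
have [e|e] : (a %/ p = b %/ p \/ a %/ p = (b %/ p).+1)%N.
(* The gap a - b is smaller than p, so at most one multiple of p lies between. *)
- have h1 : (b %/ p <= a %/ p)%N by apply: leq_div2r; lia.
  have h2 : (a %/ p <= (b %/ p).+1)%N.
    by rewrite -ltnS ltn_divLR ?mulSn; lia.
  lia.
- rewrite e in ea; lia.
- rewrite e mulSn in ea; lia.
Qed.

(** The slack hypothesis handles both uses of rounding.  If q'/p' <= q/p it
    holds for every x.  If q'p exceeds qp' by exactly 1, it says that xp' is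
    not a multiple of p: the fractional part of xp'/p is then at least 1/p,
    which makes up for the missing 1/p. *)
Lemma floor_gap (p q p' q' x y : nat) : (0 < p)%N ->
  (q' * p <= q * p' + (x * p') %% p)%N -> (x + q <= y)%N ->
  (x * p' %/ p + q' <= y * p' %/ p)%N.
Proof.
move=> p0 gap xy; rewrite leq_divRL // mulnDl.
have /(leq_trans _) -> // : ((x + q) * p' <= y * p')%N by rewrite leq_mul2r xy orbT.
by have := divn_eq (x * p') p; lia.
Qed.

(** The offset s rotates the source circle; it moves the vertex at which the
    map between neighbouring fractions fails. *)
Definition round_map (p p' : nat) (p'_gt0 : (0 < p')%N) (s : nat) (u : 'I_p) :
    'I_p' :=
  Ordinal (ltn_pmod ((u + s) * p' %/ p) p'_gt0).

Lemma round_map_cohom (p q p' q' s : nat) (p'_gt0 : (0 < p')%N) :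
  (0 < q)%N -> (0 < q')%N ->
  cohom_on (fraction_graph p q) (fraction_graph p' q')
    (fun u : 'I_p => q' * p <= q * p' + ((u + s) * p') %% p)%N
    (round_map p p' p'_gt0 s).
Proof.
move=> q0 q'0 u v; have p0 : (0 < p)%N by case: (p) u => [[]|].
wlog suff H : u v / (v + q <= u)%N && (u + q <= v + p)%N ->
    (q' * p <= q * p' + ((u + s) * p') %% p)%N ->
    (q' * p <= q * p' + ((v + s) * p') %% p)%N ->
    separated (fraction_graph p' q') (round_map p p' p'_gt0 s u)
      (round_map p p' p'_gt0 s v).
  move=> gu gv; rewrite fraction_separatedE // => /orP[/H->//|/H].
  by rewrite separated_sym => ->.
move=> /andP[vu uv] gu gv; apply: separated_mod => //.
  by apply: (@floor_gap _ q) => //; lia.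
(* The arc from u around to v is the gap from u to v + p on the line, and
   rounding turns the shift by p into a shift by p'. *)
rewrite [leqRHS]addnC -divnMDl // [(p' * p)%N]mulnC -mulnDl.
by apply: (@floor_gap _ q) => //; lia.
Qed.

Lemma fraction_graph_le (p q p' q' : nat) :
  (0 < q)%N -> (0 < q')%N -> (0 < p')%N -> (p * q' <= p' * q)%N ->
  cohom_le (fraction_graph p q) (fraction_graph p' q').
Proof.
move=> q0 q'0 p'0 le_pq.
apply: (cohom_le_separated (fraction_graph p q) (fraction_graph p' q')
  (round_map p p' p'0 0)) => u v _ _.
by apply: round_map_cohom => //=; lia.
Qed.

Lemma fraction_graph_le_empty (p q n : nat) :
  (0 < p)%N -> (0 < q)%N -> (p <= n * q)%N ->
  cohom_le (fraction_graph p q) (empty_graph n).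
Proof.
move=> p0 q0 le_pn; have n0 : (0 < n)%N by case: n le_pn => //; lia.
(* E_{n/1} has no edges and the same vertices as the empty graph. *)
have [f fP] : cohom_le (fraction_graph p q) (fraction_graph n 1).
  by apply: fraction_graph_le => //; rewrite muln1.
by exists f => u v uv euv; have [? _] := fP _ _ uv euv.
Qed.

(** With the offset p - j, rounding from E_{p/q} to the lower neighbour
    E_{p'/q'} fails only at the vertex j, since p and p' are coprime. *)
Lemma spectrum_fraction_neighbours (R : realType) (F : sgraph -> R)
    (p q p' q' n : nat) :
  asymptotic_spectrum F -> (0 < q)%N -> (0 < p')%N -> (0 < q')%N ->
  (p * q' = p' * q + 1)%N -> (n < p)%N ->
  F (fraction_graph p q) ^+ n <= n.+1%:R * F (fraction_graph p' q') ^+ n.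
Proof.
move=> FX q0 p'0 q'0 det ltnp.
pose x := fun j : 'I_n.+1 => widen_ord ltnp j : vertex (fraction_graph p q).
apply: (spectrum_power_le _ F (fraction_graph p q) (fraction_graph p' q') n x
  (fun j => round_map p p' p'0 (p - j))) => // [j k /(congr1 val)/=/val_inj //|j].
have ltj : (j < p)%N := leq_trans (ltn_ord j) ltnp.
have p0 : (0 < p)%N by lia.
suff gap (u : 'I_p) : u != x j ->
    (q' * p <= q * p' + ((u + (p - j)) * p') %% p)%N.
  by move=> u v /gap gu /gap gv; apply: round_map_cohom.
move=> uj; suff : (0 < ((u + (p - j)) * p') %% p)%N by lia.
have cop : coprime p p'.
  rewrite /coprime -dvdn1 -(dvdn_addr 1 (m := p' * q)) -?det;
  by rewrite dvdn_mulr // ?dvdn_gcdl ?dvdn_gcdr.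
rewrite lt0n -/(dvdn _ _) Gauss_dvdl //; apply: contra uj => dvd.
have ltu := ltn_ord u; apply/eqP/val_inj => /=.
(* u + (p - j) lies strictly between 0 and 2p, so the multiple is p itself. *)
have /dvdnP[k] := dvd; case: k => [|[|k]]; rewrite ?mulSn; lia.
Qed.

(** * Neighbouring fractions around an irrational number *)

(** Mediants with the upper end p/q are inserted as long as they stay below r,
    which can happen only finitely often because p/q > r; the last one below r
    and the first one above r are the next pair of neighbours.  The new upper
    numerator exceeds p, so iterating makes it arbitrarily large. *)
Lemma exists_neighbours (R : realType) (r : R) (N : nat) :
  1 <= r -> @irrational R r ->
  exists p q p' q' : nat, [/\ (N < p)%N, [/\ (0 < q)%N, (0 < p')%N & (0 < q')%N],
    (p * q' = p' * q + 1)%N, p'%:R < r * q'%:R & r * q%:R < p%:R].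
Proof.
move=> r1 irr.
have neq (a b : nat) : (0 < b)%N -> r * b%:R != a%:R.
  move=> b0; apply/eqP => e; apply: irr.
  apply/rationalP; exists a%:Z, b; rewrite -[a%:~R]/(a%:R) -e mulfK //.
  by rewrite pnatr_eq0 -lt0n.
elim: N => [|N [p [q [p' [q' [ltNp [q0 p'0 q'0] det lo hi]]]]]].
  exists (Num.truncn r).+1, 1%N, (Num.truncn r), 1%N.
  have /andP[lo hi] := truncn_itv (le_trans ler01 r1).
  split; rewrite ?mulr1 //; last 2 [lia]; first by rewrite truncn_gt0.
  rewrite lt_neqAle lo andbT eq_sym; have := neq (Num.truncn r) 1%N isT.
  by rewrite mulr1.
have ex : exists k, r * (q' + k * q)%:R < (p' + k * p)%:R.
  have d0 : 0 < p%:R - r * q%:R by rewrite subr_gt0.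
  (* Solving r (q' + k q) < p' + k p for k gives this threshold. *)
  have := truncnS_gt ((r * q'%:R - p'%:R) / (p%:R - r * q%:R)).
  move: _.+1 => k; rewrite ltr_pdivrMr // => ltk; exists k.
  rewrite !natrD !natrM; lra.
case: (ex_minnP ex) => -[|k] ltk mink.
  by move: ltk; rewrite !mul0n !addn0 => /(lt_trans lo); rewrite ltxx.
exists (p' + k.+1 * p)%N, (q' + k.+1 * q)%N, (p' + k * p)%N, (q' + k * q)%N.
split => //; [by rewrite mulSn; lia|by split; lia|by rewrite !mulSn; nia|].
rewrite lt_neqAle eq_sym neq ?andTb; last by lia.
by rewrite leNgt; apply/negP => /mink; rewrite ltnn.
Qed.

(** * Comparing numbers through their powers *)

(** For n = 2m, Bernoulli's inequality gives
    (1 + x)^n >= (1 + m x)^2 = 1 + 2 m x + m^2 x^2, and the quadratic term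
    reaches n = 2m as soon as m x^2 >= 2. *)
Lemma linear_lt_exponential (R : realType) (x : R) : 0 < x ->
  exists n : nat, n.+1%:R < (1 + x) ^+ n.
Proof.
move=> x0; pose m := (Num.truncn (2 / x ^+ 2)).+1.
exists (2 * m)%N; have x20 : 0 < x ^+ 2 by rewrite exprn_gt0.
have := truncnS_gt (2 / x ^+ 2); rewrite -/m ltr_pdivrMr // => mx.
have bern : 1 + m%:R * x <= (1 + x) ^+ m.
  elim: (m) => [|k IHk]; first by rewrite mul0r addr0.
  by rewrite exprS -natr1; have := ler0n R k; nra.
have m0 : 1 <= m%:R :> R by rewrite ler1n.
rewrite mulnC exprM -natr1 natrM; apply: (@lt_le_trans _ _ ((1 + m%:R * x) ^+ 2)).
  have -> : (1 + m%:R * x) ^+ 2 = 1 + m%:R * 2 * x + m%:R * (m%:R * x ^+ 2) by lra.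
  nra.
by rewrite lerXn2r // nnegrE; nra.
Qed.

(** The integer n depends only on C and e: this is what makes the comparison
    uniform over the asymptotic spectrum. *)
Lemma power_ratio_bound (R : realType) (C e : R) : 0 < C -> 0 < e ->
  exists n : nat, forall a b : R, 0 <= b -> b <= C ->
    a ^+ n <= n.+1%:R * b ^+ n -> a <= b + e.
Proof.
move=> C0 e0; have [n ltn] := linear_lt_exponential R (e / C) (divr_gt0 e0 C0).
have n0 : (0 < n)%N by case: n ltn => // ; rewrite expr0 ltxx.
exists n => a b b0 bC; rewrite [a <= _]leNgt; apply: contraTN => lta; rewrite -ltNge.
have [->|b_neq0] := eqVneq b 0.
  by rewrite expr0n gtn_eqF // mulr0 exprn_gt0 //; lra.
have {}b0 : 0 < b by rewrite lt_neqAle eq_sym b_neq0.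
apply: (@lt_le_trans _ _ ((1 + e / C) ^+ n * b ^+ n)).
  by rewrite ltr_pM2r // exprn_gt0.
rewrite -exprMn lerXn2r ?nnegrE //.
- by rewrite mulr_ge0 ?addr_ge0 ?divr_ge0 ?ltW.
- by lra.
rewrite (le_trans _ (ltW lta)) // mulrDl mul1r lerD2l.
by rewrite mulrAC ler_pdivrMr // ler_wpM2l // ltW.
Qed.

(** * Convergence to an irrational number *)

Theorem theorem1p2 (R : realType) (r : R) (p q : nat -> nat)
  (hr2 : 2 <= r) (hr : @irrational R r)
  (hp : forall n, (0 < p n)%N) (hq : forall n, (0 < q n)%N)
  (hpq : forall n, 2 <= (p n)%:R / (q n)%:R :> R)
  (hlim : (fun n => (p n)%:R / (q n)%:R : R) @ \oo --> r) :
  spectrum_cauchy R (fun n => fraction_graph (p n) (q n)).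
Proof.
move=> e e0; set C := (Num.truncn r).+1.
have [n bound] := power_ratio_bound R C%:R e (ltr0Sn _ _) e0.
have [||P [Q [P' [Q' [ltnP [Q0 P'0 Q'0] det lo hi]]]]] := exists_neighbours R r n.
- by lra.
- by [].
have Qr0 : 0 < Q%:R :> R by rewrite ltr0n.
have Q'r0 : 0 < Q'%:R :> R by rewrite ltr0n.
have [N _ near_r] : \forall k \near \oo,
    P'%:R / Q'%:R < (p k)%:R / (q k)%:R :> R /\ (p k)%:R / (q k)%:R < P%:R / Q%:R :> R.
  apply: filterS2 (cvgr_gt _ hlim (P'%:R / Q'%:R) _) (cvgr_lt _ hlim (P%:R / Q%:R) _) => //.
  - by rewrite ltr_pdivrMr.
  - by rewrite ltr_pdivlMr.
exists N => i j /ltnW/near_r Ni /ltnW/near_r Nj.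
apply: ge_ereal_sup => _ [F FX ->]; rewrite lee_fin.
pose b := F (fraction_graph P' Q'); pose a := F (fraction_graph P Q).
have ab : a <= b + e.
  apply: bound; first exact: (spectrum_ge0 FX).
    rewrite -(spectrum_empty FX C); apply/(spectrum_le FX)/fraction_graph_le_empty => //.
    rewrite -(ler_nat R) natrM; apply: ltW; apply: lt_le_trans lo _.
    by rewrite ler_wpM2r // ltW // truncnS_gt.
  exact: spectrum_fraction_neighbours.
have sandwich k : P'%:R / Q'%:R < (p k)%:R / (q k)%:R :> R /\
    (p k)%:R / (q k)%:R < P%:R / Q%:R :> R ->
  b <= F (fraction_graph (p k) (q k)) <= a.
  have qk : 0 < (q k)%:R :> R by rewrite ltr0n.
  rewrite ltr_pdivrMr // mulrAC ltr_pdivlMr // ltr_pdivrMr // mulrAC ltr_pdivlMr //.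
  rewrite -!natrM !ltr_nat => -[lo_k hi_k].
  apply/andP; split; apply: (spectrum_le FX).
    exact: fraction_graph_le Q'0 (hq k) (hp k) (ltnW lo_k).
  apply: fraction_graph_le (hq k) Q0 _ (ltnW hi_k).
  exact: leq_ltn_trans ltnP.
have /andP[bi ia] := sandwich i Ni; have /andP[bj ja] := sandwich j Nj.
by rewrite ler_norml; apply/andP; split; lra.
Qed.
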